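(* Let $G$ and $H$ be triangulated planar graphs on the same vertex set $V$ with $|V|\geq 7$. If $G$ and $H$ have the same set of connected triples, then $G=H$.
   Context: All graphs are finite and simple. A triangulated (maximal) planar graph is a planar graph that has a plane embedding in which every face, including the outer face, is bounded by a triangle. A connected triple of a graph $G$ is a $3$-element subset $\{a,b,c\}\subseteq V(G)$ such that $G[\{a,b,c\}]$ is connected. Graphs are labelled: equality means equal edge sets. *)

(* Defs.v *)
From HB Require Import structures.
From mathcomp Require Import all_boot all_order all_fingroup.

Set Implicit Arguments.
Unset Strict Implicit.
Unset Printing Implicit Defensive.

Record sgraph (V : finType) := SGraph {
  adj :> rel V;
  adj_sym : symmetric adj;
  adj_irrefl : irreflexive adj
}.

Section Graphs.
Variables (V : finType) (G : sgraph V).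

Definition darts : {set V * V} := [set d | G d.1 d.2].

Definition edges : {set {set V}} := [set [set d.1; d.2] | d in darts].

Definition induced_rel (A : {set V}) : rel V :=
  [rel x y | [&& x \in A, y \in A & G x y]].

Definition induced_connected (A : {set V}) : bool :=
  (A != set0) && [forall x in A, forall y in A, connect (induced_rel A) x y].

Definition connected_triples : {set {set V}} :=
  [set A : {set V} | (#|A| == 3) && induced_connected A].

Definition connected_graph : bool := induced_connected [set: V].

(* Embeddings are combinatorial, as in the hypermap treatments of planarity
   (Gonthier, Doczkal): an embedding of a connected graph in an oriented closed
   surface is given, up to homeomorphism, by the cyclic order rho v in which
   the neighbours of each vertex v are met when turning around v. *)
Definition rotation_system (rho : V -> {perm V}) : Prop :=
  forall v x, G v x -> porbit (rho v) x = [set y | G v y].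

Section Faces.
Variable rho : V -> {perm V}.

(* Walking along a face boundary: after going from x to y, leave y along the
   edge that follows yx in the rotation at y. *)
Definition face_step (d : V * V) : V * V := (d.2, rho d.2 d.1).

Lemma face_step_inj : injective face_step.
Proof. by move=> [x y] [x' y'] [/= <- /perm_inj ->]. Qed.

Definition face_perm : {perm V * V} := perm face_step_inj.

(* A face is represented by its boundary walk, the set of darts on it; the
   outer face is one of these orbits, like any other. *)
Definition faces : {set {set V * V}} := porbit face_perm @: darts.

(* Gluing a disc along each boundary walk gives a closed oriented connected
   surface, of Euler characteristic #|V| - #|edges| + #|faces|; it is the
   sphere, i.e. the plane with a point at infinity added, iff this number
   is 2. *)
Definition plane_embedding : Prop :=
  [/\ connected_graph, rotation_system rho
    & #|V| + #|faces| = #|edges| + 2].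

Definition bounded_by_triangle (F : {set V * V}) : Prop :=
  exists x y z, [/\ G x y, G y z, G z x & F = [set (x, y); (y, z); (z, x)]].

End Faces.

(* Connectedness, built into plane_embedding, costs no generality here: a
   disconnected plane graph has a face whose boundary meets two components. *)
Definition triangulated_planar : Prop :=
  exists rho, plane_embedding rho /\
    forall F, F \in faces rho -> bounded_by_triangle F.

End Graphs.

(* Main.v *)
(* Call a pair on which G and H disagree a difference. A triple is connected iff
   it spans at least two edges, so differences at a common vertex alternate
   between G and H, and a vertex in no difference with u or v is adjacent to
   both or to neither end of a difference uv. Hence every component K of the
   difference graph is a path or a cycle, and a module of G and of H with some
   outer neighbourhood S.
   - If |S| <= 2, then V = K + S because triangulations have no small cuts, and
     since all other pairs of K have the same type, K is (up to a matching)
     independent or complete in G, against |E(G)| = 3n - 6.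
   - If |S| >= 3, then |K| = 2 because G has no K_{3,3}.
   So all differences are isolated. The ends of one in G \ H are twins in H, and
   twins u, v in a triangulation force it to be the bipyramid over N(u), where
   the other vertices have degree 4. As |E(G)| = |E(H)| there is also a
   difference xy in H \ G, and the same argument in G makes x adjacent to n - 2
   vertices in G, hence in H: a contradiction.
   The absence of K_{3,3} comes from the Jordan curve theorem in the following
   form: by Euler's formula the mod 2 face boundaries span the cycle space. *)
Require Import Defs.
From HB Require Import structures.
From mathcomp Require Import all_boot all_order all_fingroup.
From mathcomp Require Import all_algebra zify.

Set Implicit Arguments.
Unset Strict Implicit.
Unset Printing Implicit Defensive.

Import GRing.Theory.

(** * Linear algebra: Euler's formula forces exactness *)

Section Exactness.
Local Open Scope ring_scope.
Variable K : fieldType.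

(** The kernel lies in the line spanned by the all-ones vector, so rank-nullity loses at most 1. *)
Lemma rank_constant_kernel m n (M : 'M[K]_(m, n)) :
  (forall x : 'rV_m, x *m M = 0 -> forall i j, x 0 i = x 0 j) ->
  (m <= (\rank M).+1)%N.
Proof.
move=> cstM; have: (\rank (kermx M) <= 1)%N.
  case: m M cstM => [|m] M cstM; first by rewrite (leq_trans (rank_leq_row _)).
  have sub : (kermx M <= (const_mx 1 : 'rV[K]_m.+1))%MS.
    apply/rV_subP => x /sub_kermxP xM0; apply/submxP.
    exists (x 0 0)%:M; rewrite mul_scalar_mx; apply/rowP => i.
    by rewrite !mxE mulr1; apply: cstM.
  exact: leq_trans (mxrankS sub) (rank_leq_row _).
by rewrite mxrank_ker leq_subLR addn1.
Qed.

(* If the kernels of [a] and of the transpose of [b] contain only constants,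
   then rank a >= #|F| - 1 and rank b >= #|V| - 1; when the Euler
   characteristic is at least 2 this leaves no room for homology. *)
Lemma exact_of_euler (F E V : finType) (a : F -> E -> K) (b : E -> V -> K) :
    (forall f v, \sum_e a f e * b e v = 0) ->
    (forall x : F -> K, (forall e, \sum_f x f * a f e = 0) ->
       forall f f', x f = x f') ->
    (forall y : V -> K, (forall e, \sum_v b e v * y v = 0) ->
       forall v v', y v = y v') ->
    (#|E| + 2 <= #|V| + #|F|)%N ->
  forall z : E -> K, (forall v, \sum_e z e * b e v = 0) ->
    exists x : F -> K, forall e, z e = \sum_f x f * a f e.
Proof.
move=> ab0 ker_a ker_b euler z zb0.
pose A := \matrix_(i < #|F|, j < #|E|) a (enum_val i) (enum_val j).
pose B := \matrix_(i < #|E|, j < #|V|) b (enum_val i) (enum_val j).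
have sumE (I : finType) (g : 'I_#|I| -> K) : \sum_i g i = \sum_i g (enum_rank i).
  by rewrite (reindex (@enum_rank I)) //; apply/onW_bij/enum_rank_bij.
have AB0 : A *m B = 0.
  apply/matrixP => i j; rewrite !mxE sumE -[RHS](ab0 (enum_val i) (enum_val j)).
  by apply: eq_bigr => e _; rewrite !mxE enum_rankK.
have rA : (#|F| <= (\rank A).+1)%N.
  apply: rank_constant_kernel => x xA0 i j.
  have := ker_a (fun f => x 0 (enum_rank f)) _ (enum_val i) (enum_val j).
  rewrite !enum_valK; apply => e.
  have /matrixP/(_ 0 (enum_rank e)) := xA0; rewrite !mxE sumE => {2}<-.
  by apply: eq_bigr => f _; rewrite !mxE !enum_rankK.
have rB : (#|V| <= (\rank B).+1)%N.
  rewrite -mxrank_tr; apply: rank_constant_kernel => x xB0 i j.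
  have := ker_b (fun v => x 0 (enum_rank v)) _ (enum_val i) (enum_val j).
  rewrite !enum_valK; apply => e.
  have /matrixP/(_ 0 (enum_rank e)) := xB0; rewrite !mxE sumE => {2}<-.
  by apply: eq_bigr => v _; rewrite !mxE !enum_rankK mulrC.
have sAB : (A <= kermx B)%MS by apply/sub_kermxP.
(* The kernel of [B] has dimension at most |E| - |V| + 1, which Euler bounds by |F| - 1, hence by
   the rank of [A]. *)
have sBA : (kermx B <= A)%MS.
  rewrite -(geq_leqif (mxrank_leqif_sup sAB)) mxrank_ker.
  by have := rank_leq_row B; lia.
have : (\row_i z (enum_val i) <= kermx B)%MS.
  apply/sub_kermxP/rowP => j; rewrite !mxE sumE -[RHS](zb0 (enum_val j)).
  by apply: eq_bigr => e _; rewrite !mxE enum_rankK.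
move=> /submx_trans/(_ sBA)/submxP[x zE]; exists (fun f => x 0 (enum_rank f)) => e.
have /rowP/(_ (enum_rank e)) := zE; rewrite !mxE enum_rankK sumE => ->.
by apply: eq_bigr => f _; rewrite !mxE !enum_rankK.
Qed.

End Exactness.

Lemma connect_closed (T : finType) (e : rel T) (A : {set T}) x y :
    (forall s t, s \in A -> e s t -> t \in A) ->
  x \in A -> connect e x y -> y \in A.
Proof.
move=> clA xA /connectP[p]; elim: p x xA => [|z p IHp] x xA /= => [_ -> //|/andP[xz]].
by apply: IHp; apply: clA xz.
Qed.

Lemma connected_closed (V : finType) (G : sgraph V) (A : {set V}) (x : V) :
    connected_graph G -> x \in A ->
    (forall y z, y \in A -> G y z -> z \in A) ->
  forall y, y \in A.
Proof.
move=> /andP[_ /forall_inP conG] xA clA y.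
have /forall_inP/(_ y (in_setT y)) := conG x (in_setT x).
by apply: connect_closed => // s t sA /and3P[_ _]; apply: clA.
Qed.

(** * Rotation systems and darts *)

Section Rotation.
Variables (V : finType) (G : sgraph V) (rho : V -> {perm V}).
Hypothesis rotG : rotation_system G rho.

Lemma adj_rho v x : G v (rho v x) = G v x.
Proof.
apply/idP/idP => vx.
  have : x \in porbit (rho v) (rho v x).
    by rewrite porbit_sym -[X in X \in _]/((rho v ^+ 1)%g x) mem_porbit.
  by rewrite rotG // inE.
have : (rho v ^+ 1)%g x \in porbit (rho v) x by apply: mem_porbit.
by rewrite rotG // inE.
Qed.

Lemma adj_rho_inv v y : G v y -> exists2 x, G v x & rho v x = y.
Proof.
move=> vy; exists ((rho v)^-1%g y); last by rewrite permKV.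
by rewrite -adj_rho permKV.
Qed.

(** Induction once around v: its neighbours form a single orbit of [rho v]. *)
Lemma rho_closed v (A : {set V}) x :
    G v x -> x \in A -> (forall y, G v y -> y \in A -> rho v y \in A) ->
  forall y, G v y -> y \in A.
Proof.
move=> vx xA clA y vy.
have : y \in porbit (rho v) x by rewrite rotG // inE.
case/porbitP => i ->.
suff /andP[] : G v ((rho v ^+ i)%g x) && ((rho v ^+ i)%g x \in A) by [].
elim: i => [|i /andP[IHv IHA]]; first by rewrite expg0 perm1 vx.
by rewrite expgSr permM adj_rho IHv clA.
Qed.

Lemma big_rho (R : Type) (idx : R) (op : Monoid.com_law idx) v (g : V -> R) :
  \big[op/idx]_(y | G v y) g (rho v y) = \big[op/idx]_(y | G v y) g y.
Proof.
rewrite [RHS](reindex_inj (@perm_inj _ (rho v))).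
by apply: eq_bigl => y; rewrite adj_rho.
Qed.

Lemma card_darts_edges : #|darts G| = 2 * #|edges G|.
Proof.
rewrite -sum1_card (partition_big_imset (fun d : V * V => [set d.1; d.2])) /=.
rewrite -/(edges G) mulnC -sum_nat_const; apply: eq_bigr => e /imsetP[[x y]].
rewrite inE /= => xy ->{e}.
have nxy : x != y by apply: contraL xy => /eqP->; rewrite adj_irrefl.
rewrite sum1dep_card -(_ : #|[set (x, y); (y, x)]| = 2); last first.
  by rewrite cards2 xpair_eqE (negPf nxy).
apply: eq_card => -[a b]; rewrite !inE /= !xpair_eqE.
apply/idP/idP => [/andP[ab /eqP/setP eab]|].
  have nab : a != b by apply: contraL ab => /eqP->; rewrite adj_irrefl.
  have := eab a; have := eab b; rewrite !inE !eqxx orbT /= => /esym/orP[]/eqP bE;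
  by move=> /esym/orP[]/eqP aE; move: nab; rewrite aE bE !eqxx ?orbT.
by case/orP=> /andP[/eqP-> /eqP->]; rewrite ?xy ?(adj_sym G y) ?xy /= ?eqxx // setUC eqxx.
Qed.

(** One dart per edge, chosen by an arbitrary enumeration of the vertices, so that sums over edges
    become sums over darts. *)
Definition forward_darts : {set V * V} :=
  [set d in darts G | enum_rank d.1 < enum_rank d.2].

Definition swap (d : V * V) : V * V := (d.2, d.1).

Lemma swapK : involutive swap. Proof. by case. Qed.

Lemma forward_swap d :
  d \in darts G -> (swap d \in forward_darts) = (d \notin forward_darts).
Proof.
case: d => x y; rewrite !inE /= (adj_sym G y x) => xy; rewrite xy /= -leqNgt.
rewrite ltn_neqAle; case: eqVneq => //= /ord_inj/enum_rank_inj yx.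
by rewrite yx adj_irrefl in xy.
Qed.

Lemma forward_or x y :
  G x y -> (x, y) \in forward_darts \/ (y, x) \in forward_darts.
Proof.
move=> xy; have [|] := boolP ((x, y) \in forward_darts); first by left.
by rewrite -forward_swap ?inE //; right.
Qed.

Lemma big_darts_forward (R : Type) (idx : R) (op : Monoid.com_law idx) (g : V * V -> R) :
  \big[op/idx]_(d in darts G) g d =
    op (\big[op/idx]_(d in forward_darts) g d)
       (\big[op/idx]_(d in forward_darts) g (swap d)).
Proof.
rewrite (bigID (mem forward_darts)) /=; congr (op _ _).
  by apply: eq_bigl => d; rewrite !inE; case: (G _ _).
rewrite (reindex_inj (can_inj swapK)); apply: eq_bigl => d.
have [dG|dNG] := boolP (swap d \in darts G) => /=.
  by rewrite -forward_swap // swapK.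
by move: dNG; rewrite !inE /= adj_sym => /negPf->.
Qed.

Lemma card_forward_darts : #|forward_darts| = #|edges G|.
Proof.
have := card_darts_edges; rewrite -sum1_card big_darts_forward /= !sum1_card addnn.
by rewrite mul2n => /double_inj.
Qed.

(** * Face boundaries mod 2 and the Jordan curve theorem *)

Section Boundary.
Local Open Scope ring_scope.

(** This evaluates the boundary of the chain [c] at v: an edge at v counts once, whichever of its
    darts is the forward one. *)
Lemma boundary_forward (R : pzRingType) (c : V * V -> R) v :
    (forall d, c (swap d) = c d) ->
  \sum_(d in forward_darts) c d * ((d.1 == v)%:R + (d.2 == v)%:R) =
  \sum_(y | G v y) c (v, y).
Proof.
move=> c_sym; pose g d := c d * (d.1 == v)%:R.
transitivity (\sum_(d in darts G) g d).
  rewrite big_darts_forward /= -big_split; apply: eq_bigr => d _ /=.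
  by rewrite /g c_sym /= mulrDr.
rewrite (eq_bigl (fun d : V * V => predT d.1 && G d.1 d.2)); last first.
  by move=> d; rewrite inE.
rewrite (eq_bigr (fun d : V * V => g (d.1, d.2))); last by case.
rewrite -(pair_big_dep predT (fun x y => G x y) (fun x y => g (x, y))) /=.
rewrite (bigD1 v) //= [X in _ + X]big1 ?addr0.
  by apply: eq_bigr => y _; rewrite /g eqxx mulr1.
by move=> x /negPf nxv; apply: big1 => y _; rewrite /g /= nxv mulr0.
Qed.

End Boundary.

Lemma face_step_porbit x v :
  porbit (face_perm rho) (v, rho v x) = porbit (face_perm rho) (x, v).
Proof.
have -> : (v, rho v x) = ((face_perm rho ^+ 1)%g (x, v)) by rewrite expg1 permE.
exact: porbit_perm.
Qed.

(* The colour of a face is attached to the darts on its boundary walk; [c] is the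
   set of edges across which it changes. *)
Definition face_coloring (col c : V -> V -> bool) : Prop :=
  (forall v x, G v x -> col v (rho v x) = col x v) /\
  (forall x y, G x y -> col x y (+) col y x = c x y).

Hypothesis conG : connected_graph G.
Hypothesis eulerG : #|V| + #|faces G rho| = #|edges G| + 2.

(* A cycle of a plane graph separates: the faces can be 2-coloured so that the
   colour changes exactly across the edges of the cycle. *)
Lemma jordan (c : V -> V -> bool) :
    symmetric c -> (forall v, ~~ odd (\sum_(y | G v y) c v y)) ->
  exists col, face_coloring col c.
Proof.
move=> c_sym c_even.
pose F : finType := {A | A \in faces G rho}.
pose E : finType := {d | d \in forward_darts}.
pose face d := porbit (face_perm rho) d.
(* Functions on the type of faces are extended by 0, so that they can be evaluated at the orbit of
   any dart. *)
pose ext (x : F -> 'F_2) A := if insub A is Some f then x f else 0%R.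
have sumE (g : V * V -> 'F_2) : (\sum_(e : E) g (val e) = \sum_(d in forward_darts) g d)%R.
  rewrite [RHS](reindex_omap (val : E -> V * V) insub) /=.
    by apply: eq_bigl => e; rewrite (valP e) valK eqxx.
  by move=> d dF; rewrite insubT.
have sumF x d : d \in darts G -> (\sum_f x f * (face d == val f)%:R = ext x (face d))%R.
  move=> dG; have fd : face d \in faces G rho by apply: imset_f.
  rewrite /ext insubT.
  rewrite (bigD1 (@exist _ (fun A => A \in faces G rho) (face d) fd : F)) //=.
  rewrite eqxx mulr1 big1 ?addr0 //= => f nf.
  rewrite (_ : _ == _ = false) ?mulr0 //.
  by apply: contraNF nf => /eqP ef; apply/eqP/val_inj.
(* [a] counts mod 2 the sides of e that lie on f, so an edge with f on both sides gets 0; [b] is the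
   incidence of edges and vertices. *)
pose a (f : F) (e : E) : 'F_2 :=
  ((face (val e) == val f)%:R + (face (swap (val e)) == val f)%:R)%R.
pose b (e : E) (v : V) : 'F_2 := (((val e).1 == v)%:R + ((val e).2 == v)%:R)%R.
have F2 (p : 'F_2) : (p + p = 0)%R.
  by case: p => [[|[|]]] // ?; apply/val_inj.
have xaE x e : (\sum_f x f * a f e = ext x (face (val e)) + ext x (face (swap (val e))))%R.
  have := valP e; rewrite inE => /andP[eG _].
  rewrite -!sumF // -?big_split /=; last by move: eG; rewrite !inE adj_sym.
  by apply: eq_bigr => f _; rewrite mulrDr.
(* The sum runs over the edges at v, each seen from both sides; turning by [rho v] identifies the
   two halves, which cancel mod 2. *)
have ab0 f v : (\sum_e a f e * b e v = 0)%R.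
  pose g d : 'F_2 := ((face d == val f)%:R + (face (swap d) == val f)%:R)%R.
  rewrite (sumE (fun d => g d * ((d.1 == v)%:R + (d.2 == v)%:R)))%R.
  rewrite boundary_forward => [|d]; last by rewrite /g swapK addrC.
  rewrite /g big_split /=.
  rewrite [X in (_ + X)%R](eq_bigr (fun y => (face (v, rho v y) == val f)%:R : 'F_2)%R).
    by rewrite (big_rho _ _ (fun y => (face (v, y) == val f)%:R : 'F_2)%R) F2.
  by move=> y _; rewrite /face face_step_porbit.
(* A face function without boundary agrees across each edge, hence all around each vertex, hence
   everywhere by connectedness. *)
have ker_a x : (forall e, \sum_f x f * a f e = 0)%R -> forall f f', x f = x f'.
  move=> x0; pose g v y := ext x (face (v, y)).
  have g_sym v y : G v y -> g v y = g y v.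
    wlog vy : v y / (v, y) \in forward_darts => [hw vy|_].
      by have [/hw->|/hw->] := forward_or vy; rewrite // adj_sym.
    have := x0 (@exist _ (fun d => d \in forward_darts) _ vy : E).
    rewrite xaE /= => /eqP; rewrite addr_eq0 => /eqP.
    by rewrite -/(g v y) -/(g y v) => ->; apply/eqP; rewrite eq_sym -addr_eq0 F2.
  have g_cst v y y' : G v y -> G v y' -> g v y' = g v y.
    move=> vy vy'; have := @rho_closed v [set w | g v w == g v y] y vy.
    rewrite inE eqxx => /(_ isT) cl; apply/eqP; have := cl _ y' vy'.
    rewrite inE; apply => w vw; rewrite !inE => /eqP <-.
    have -> : g v (rho v w) = g w v by rewrite /g /face face_step_porbit.
    by rewrite g_sym // adj_sym.
  have ext_cst v y v' y' : G v y -> G v' y' -> g v' y' = g v y.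
    move=> vy; have : v' \in [set w | [forall z, G w z ==> (g w z == g v y)]].
      apply: (connected_closed (x := v) conG) => [|w z].
        by rewrite inE; apply/forall_inP => z vz; apply/eqP/g_cst.
      rewrite !inE => /forall_inP cw wz; apply/forall_inP => t zt.
      have zw : G z w by rewrite adj_sym.
      by rewrite (g_cst _ _ _ zw zt) -g_sym //; apply: cw.
    by rewrite inE => /forall_inP h /h /eqP.
  have val_ext f : exists2 d, G d.1 d.2 & x f = g d.1 d.2.
    have /imsetP[[v y] vy fE] := valP f; exists (v, y); first by rewrite inE in vy.
    by rewrite /g /ext /face -fE /= valK.
  move=> f f'; have [[v y] vy ->] := val_ext f; have [[v' y'] vy' ->] := val_ext f'.
  exact: ext_cst.
have ker_b y : (forall e, \sum_v b e v * y v = 0)%R -> forall v v', y v = y v'.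
  move=> y0.
  have y_adj v w : G v w -> y v = y w.
    wlog vw : v w / (v, w) \in forward_darts => [hw vw|_].
      by have [/hw->|/hw->] := forward_or vw; rewrite // adj_sym.
    have := y0 (@exist _ (fun d => d \in forward_darts) _ vw : E).
    rewrite (eq_bigr (fun u => (v == u)%:R * y u + (w == u)%:R * y u))%R; last first.
      by move=> u _; rewrite mulrDl.
    have delta u : (\sum_t (u == t)%:R * y t = y u)%R.
      rewrite (bigD1 u) //= eqxx mul1r big1 ?addr0 // => t.
      by rewrite eq_sym => /negPf->; rewrite mul0r.
    rewrite big_split /= !delta => /eqP; rewrite addr_eq0 => /eqP->.
    by apply/eqP; rewrite eq_sym -addr_eq0 F2.
  move=> v v'; have := @connected_closed V G [set w | y v == y w] v conG.
  rewrite inE eqxx => /(_ isT) cl; apply/eqP; have := cl _ v'; rewrite inE; apply.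
  by move=> w z; rewrite !inE => /eqP-> /y_adj->.
have cardE : #|E| + 2 <= #|V| + #|F|.
  have -> : #|E| = #|forward_darts| by rewrite card_sig; apply: eq_card.
  have -> : #|F| = #|faces G rho| by rewrite card_sig; apply: eq_card.
  by rewrite eulerG card_forward_darts.
(* Evenness says that [c] is a cycle mod 2, so it bounds a set [x] of faces; the colour is
   membership in that set. *)
have [|x xE] := exact_of_euler ab0 ker_a ker_b cardE (z := fun e => (c (val e).1 (val e).2)%:R%R).
  move=> v; rewrite (sumE (fun d => (c d.1 d.2)%:R * ((d.1 == v)%:R + (d.2 == v)%:R)))%R.
  rewrite boundary_forward /= => [|d]; last by rewrite c_sym.
  rewrite -natr_sum -(odd_double_half (\sum_(y | _) _)) (negPf (c_even v)).
  by rewrite -mul2n natrM (_ : 2%:R = 0)%R ?mul0r //; apply/val_inj.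
have add_neq0 (p q : 'F_2) : (p != 0)%R (+) (q != 0)%R = (p + q != 0)%R.
  by case: p q => [[|[|]]] // ? [[|[|]]].
exists (fun v y => (ext x (face (v, y)) != 0)%R); split=> [v y vy|].
  by rewrite /face face_step_porbit.
move=> v y vy; wlog fvy : v y vy / (v, y) \in forward_darts => [hw|].
  have [/(hw _ _ vy)//|fyv] := forward_or vy.
  by rewrite c_sym addbC hw // adj_sym.
have := xE (@exist _ (fun d => d \in forward_darts) _ fvy : E); rewrite xaE /= add_neq0 => <-.
by case: (c v y).
Qed.

End Rotation.

Lemma addb_eqF (a b : bool) : a (+) b = false -> b = a.
Proof. by case: a b => [] []. Qed.

(** * Quadrilaterals as separating curves, and the exclusion of K_{3,3} *)

Section Coloring.
Variables (V : finType) (G : sgraph V) (rho : V -> {perm V}).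
Hypothesis rotG : rotation_system G rho.
Hypothesis conG : connected_graph G.
Hypothesis eulerG : #|V| + #|faces G rho| = #|edges G| + 2.

Lemma face_coloringD col c col' c' :
  face_coloring G rho col c -> face_coloring G rho col' c' ->
  face_coloring G rho (fun x y => col x y (+) col' x y) (fun x y => c x y (+) c' x y).
Proof.
move=> [rc dc] [rc' dc']; split=> [v x vx|x y xy]; first by rewrite rc ?rc'.
by rewrite -dc // -dc' // addbACA.
Qed.

(** With no edge of [c] at w, the colour persists all the way around w; it can be read on darts
    leaving or entering w. *)
Lemma face_coloring_const col c w y y' :
    face_coloring G rho col c -> (forall x, c w x = false) -> G w y -> G w y' ->
  (col w y' = col w y) * (col y' w = col w y).
Proof.
move=> [rc dc] cw0 wy wy'.
have eqc x : G w x -> col x w = col w x.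
  by move=> wx; apply: addb_eqF; rewrite dc.
have : y' \in [set x | col w x == col w y].
  apply: (rho_closed rotG wy) wy' => [|x wx]; rewrite inE //.
  by rewrite !inE rc ?eqc.
by rewrite inE => /eqP colE; rewrite eqc.
Qed.

(** The edge set of the 4-cycle u, a, v, b. *)
Definition quad (u a v b x y : V) : bool :=
  ((x \in [:: u; v]) && (y \in [:: a; b])) ||
  ((x \in [:: a; b]) && (y \in [:: u; v])).

Lemma quad_sym u a v b : symmetric (quad u a v b).
Proof. by move=> x y; rewrite /quad orbC andbC [X in _ || X]andbC. Qed.

Lemma quad_even u a v b w :
    u != v -> a != b -> {in [:: u; v] & [:: a; b], forall x y, G x y} ->
  ~~ odd (\sum_(y | G w y) quad u a v b w y).
Proof.
move=> uv ab adjG.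
have disj x : x \in [:: u; v] -> x \in [:: a; b] -> False.
  by move=> xu xa; have := adjG x x xu xa; rewrite adj_irrefl.
have pairE x y : x != y -> G w x -> G w y -> \sum_(t | G w t) (t \in [:: x; y]) = 2.
  move=> xy wx wy; rewrite (bigD1 x) // (bigD1 y) /=; last by rewrite wy eq_sym.
  rewrite !inE !eqxx orbT big1 // => t /andP[/andP[_ /negPf tx] /negPf ty].
  by rewrite !inE tx ty.
have [wu|wu] := boolP (w \in [:: u; v]).
  rewrite (eq_bigr (fun y => (y \in [:: a; b]) : nat)).
    by rewrite pairE // adjG // !inE eqxx ?orbT.
  move=> y _; rewrite /quad wu /=; case: (boolP (w \in [:: a; b])) => [/(disj _ wu)//|_].
  by rewrite orbF.
have [wa|wa] := boolP (w \in [:: a; b]).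
  rewrite (eq_bigr (fun y => (y \in [:: u; v]) : nat)).
    by rewrite pairE // adj_sym adjG // !inE eqxx ?orbT.
  by move=> y _; rewrite /quad wa (negPf wu).
by rewrite big1 // => y _; rewrite /quad (negPf wu) (negPf wa).
Qed.

Lemma quad_coloring u a v b :
    u != v -> a != b -> {in [:: u; v] & [:: a; b], forall x y, G x y} ->
  exists col, face_coloring G rho col (quad u a v b).
Proof.
move=> uv ab adjG; apply: jordan => //; first exact: quad_sym.
by move=> w; apply: quad_even.
Qed.

(* Let [p] and [q] colour the two sides of the cycles uavb and ubvc, with z
   coloured (P, Q). Since z is adjacent to c, a and b, where respectively p, q
   and p + q do not change, every corner at u next to c, a, b has p = P, q = Q
   and p + q = P + Q. So turning once around u, the condition "p <> P and
   q = Q" changes at a only, which is absurd. *)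
Lemma no_K33 u v z a b c :
    uniq [:: u; v; z] -> uniq [:: a; b; c] ->
    {in [:: u; v; z] & [:: a; b; c], forall x y, G x y} -> False.
Proof.
move=> /= /andP[]; rewrite !inE !negb_or => /andP[uv uz] /andP[vz _].
move=> /andP[/andP[ab ac] /andP[bc _]] adjG.
have ne x y : x \in [:: u; v; z] -> y \in [:: a; b; c] -> (x == y = false) * (y == x = false).
  move=> xu ya; rewrite [y == x]eq_sym; suff -> : x == y = false by [].
  by apply/eqP => xy; have := adjG x y xu ya; rewrite xy adj_irrefl.
have [mu mv mz] : [/\ u \in [:: u; v; z], v \in [:: u; v; z] & z \in [:: u; v; z]].
  by rewrite !inE !eqxx !orbT.
have [ma mb mc] : [/\ a \in [:: a; b; c], b \in [:: a; b; c] & c \in [:: a; b; c]].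
  by rewrite !inE !eqxx !orbT.
have neE := (ne _ _ mu ma, ne _ _ mu mb, ne _ _ mu mc, ne _ _ mv ma,
  ne _ _ mv mb, ne _ _ mv mc, ne _ _ mz ma, ne _ _ mz mb, ne _ _ mz mc).
have [p colp] : exists p, face_coloring G rho p (quad u a v b).
  apply: quad_coloring => // x y; rewrite !inE => xE yE; apply: adjG; rewrite !inE.
    by case/orP: xE => ->; rewrite ?orbT.
  by case/orP: yE => ->; rewrite ?orbT.
have [q colq] : exists q, face_coloring G rho q (quad u b v c).
  apply: quad_coloring => // x y; rewrite !inE => xE yE; apply: adjG; rewrite !inE.
    by case/orP: xE => ->; rewrite ?orbT.
  by case/orP: yE => ->; rewrite ?orbT.
have colr := face_coloringD colp colq.
have [cu cz au az] : [/\ G c u, G c z, G a u & G a z].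
  by split; rewrite adj_sym adjG.
have [bu bz] : G b u /\ G b z by split; rewrite adj_sym adjG.
have pz x y : x \in [:: a; b; c] -> y \in [:: a; b; c] -> p x z = p z y.
  move=> xa ya; refine (face_coloring_const colp _ (adjG z y mz ya) (adjG z x mz xa)).2 => t.
  by rewrite /quad !inE !neE ![z == _]eq_sym (negPf uz) (negPf vz).
have qz x y : x \in [:: a; b; c] -> y \in [:: a; b; c] -> q x z = q z y.
  move=> xa ya; refine (face_coloring_const colq _ (adjG z y mz ya) (adjG z x mz xa)).2 => t.
  by rewrite /quad !inE !neE ![z == _]eq_sym (negPf uz) (negPf vz).
have pc : (p u c = p z c) * (p c u = p z c).
  rewrite -(pz c c) //; have [] := face_coloring_const colp _ cz cu (w := c).
    by move=> t; rewrite /quad !inE !neE ![c == _]eq_sym (negPf ac) (negPf bc).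
  by move=> -> ->.
have qa : (q u a = q z a) * (q a u = q z a).
  rewrite -(qz a a) //; have [] := face_coloring_const colq _ az au (w := a).
    by move=> t; rewrite /quad !inE !neE (negPf ac) (negPf ab).
  by move=> -> ->.
have rb : (p u b (+) q u b = p z c (+) q z a) * (p b u (+) q b u = p z c (+) q z a).
  rewrite -(qz b a) // -(pz b c) //; have [] := face_coloring_const colr _ bz bu (w := b).
    move=> t; rewrite /quad !inE !neE !eqxx /= orbT /=.
    by rewrite addbb.
  by move=> -> ->.
pose t x := (p u x (+) p z c) && ~~ (q u x (+) q z a).
have ua : G u a by apply: adjG.
(* Reindexing by [rho u] preserves the number of x with [t x]. The terms other than a agree on both
   sides, so those at a must agree too, although p changes across ua while q equals Q on both sides
   of it. *)
have := big_rho rotG addn u (fun x => nat_of_bool (t x)).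
rewrite (bigD1 a) //= [RHS](bigD1 a) //=.
rewrite [X in _ + X = _](eq_bigr (fun x => nat_of_bool (t x))); last first.
  move=> x /andP[ux xa]; congr nat_of_bool; rewrite /t.
  have [-> ->] : p u (rho u x) = p x u /\ q u (rho u x) = q x u.
    by rewrite (colp.1 _ _ ux) (colq.1 _ _ ux).
  have [->|xb] := eqVneq x b.
    case: rb; case: (p z c); case: (q z a);
    by case: (p u b); case: (q u b); case: (p b u); case: (q b u).
  have [->|xc] := eqVneq x c; first by rewrite !pc addbb.
  have -> : p x u = p u x.
    apply: addb_eqF; rewrite colp.2 // /quad !inE (negPf xa) (negPf xb) andbF.
    by rewrite !neE.
  have -> // : q x u = q u x.
  apply: addb_eqF; rewrite colq.2 // /quad !inE (negPf xc) (negPf xb) andbF.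
  by rewrite !neE.
move/eqP; rewrite eqn_add2r /t (colp.1 _ _ ua) (colq.1 _ _ ua) !qa addbb !andbT.
have := colp.2 _ _ ua; rewrite /quad !inE !eqxx /= => pE.
by move: pE; case: (p z c); case: (p u a); case: (p a u).
Qed.

End Coloring.

(** * Triangulations: consecutive neighbours, edge count, small cuts and twins *)

Section Triangulation.
Variables (V : finType) (G : sgraph V) (rho : V -> {perm V}).
Hypothesis rotG : rotation_system G rho.
Hypothesis conG : connected_graph G.
Hypothesis eulerG : #|V| + #|faces G rho| = #|edges G| + 2.
Hypothesis triG : forall F, F \in faces G rho -> bounded_by_triangle G F.

(** The face walk through x, v and [rho v x] is a triangle, so it closes up along an edge back to
    x. *)
Lemma rho_face v x : G v x -> G x (rho v x).
Proof.
move=> vx; have xv : G x v by rewrite adj_sym.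
have /triG[a [b [c [ab bc ca FE]]]] : porbit (face_perm rho) (x, v) \in faces G rho.
  by apply: imset_f; rewrite inE.
have := porbit_id (face_perm rho) (x, v).
have := porbit_id (face_perm rho) (v, rho v x); rewrite face_step_porbit FE !inE !xpair_eqE.
have irr s t : G s t -> (s == t = false) * (t == s = false).
  by move=> st; rewrite [t == s]eq_sym; case: eqP => // e; rewrite e adj_irrefl in st.
have irrE := (irr _ _ ab, irr _ _ bc, irr _ _ ca).
case/orP=> [/orP[]|] /andP[/eqP vE /eqP->]; rewrite vE !irrE !eqxx ?andbF ?andbT ?orbF /=;
  by move/eqP->; rewrite adj_sym.
Qed.

(** Each face has three darts, so 2|E| = 3|F|, and Euler gives |E| = 3|V| - 6; doubled and without
    subtraction, this is the equation. *)
Lemma card_darts : #|darts G| + 12 = 6 * #|V|.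
Proof.
have : #|darts G| = 3 * #|faces G rho|.
  rewrite -sum1_card (partition_big_imset (porbit (face_perm rho))) /=.
  rewrite -/(faces G rho) mulnC -sum_nat_const; apply: eq_bigr => F FG.
  have [x [y [z [xy yz zx FE]]]] := triG FG; rewrite sum1dep_card.
  have ne s t : G s t -> s == t = false.
    by move=> st; case: eqP => // e; rewrite e adj_irrefl in st.
  have <- : #|F| = 3.
    rewrite FE setUC cardsU1 cards2 !inE !xpair_eqE (ne _ _ xy) (ne _ _ zx).
    by rewrite [z == y]eq_sym (ne _ _ yz).
  apply: eq_card => d; rewrite !inE; have /imsetP[d0 _ F0] := FG.
  rewrite F0 eq_porbit_mem -F0; apply: andb_idl; rewrite FE !inE.
  by case/orP=> [/orP[]|] /eqP->.
move: eulerG (card_darts_edges G); clear; lia.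
Qed.

Lemma rho_exit v (A : {set V}) x y :
    G v x -> x \in A -> G v y -> y \notin A ->
  exists t, [/\ G v t, t \in A & rho v t \notin A].
Proof.
move=> vx xA vy yA.
have [/existsP[t /and3P[]]|/existsPn noexit] :=
  boolP [exists t, [&& G v t, t \in A & rho v t \notin A]]; first by exists t.
case/negP: yA; apply: (rho_closed rotG vx) vy => // t vt tA.
by have := noexit t; rewrite vt tA /= negbK.
Qed.

(* At a vertex w of S with a neighbour outside, the rotation must leave both K
   and the outside, each time through S \ {w}, which is a single vertex. *)
Lemma no_small_cut (K S : {set V}) x :
    x \in K -> #|S| <= 2 ->
    (forall w, w \in S -> exists2 y, y \in K & G w y) ->
    (forall y z, y \in K -> G y z -> z \in K :|: S) ->
  K :|: S = setT.
Proof.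
move=> xK leS2 adjSK outK; apply/setP => y0; rewrite in_setT.
apply: (connected_closed conG (x := x)) => [|w z wKS wz]; first by rewrite inE xK.
have [wK|wK] := boolP (w \in K); first exact: outK wz.
have wS : w \in S by move: wKS; rewrite inE (negPf wK).
apply/idPn => zKS; have [k kK wk] := adjSK w wS.
have zK : z \notin K by apply: contraNN zKS => zK; rewrite inE zK.
have [k1 [wk1 k1K rk1]] := rho_exit wk kK wz zK.
have [z1 [wz1 z1Z rz1]] : exists t,
    [/\ G w t, t \in ~: (K :|: S) & rho w t \notin ~: (K :|: S)].
  by apply: rho_exit wz _ wk _; rewrite inE // negbK inE kK.
have rk1S : rho w k1 \in S.
  by have := outK _ _ k1K (rho_face wk1); rewrite inE (negPf rk1).
have rz1S : rho w z1 \in S.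
  rewrite !inE negbK in rz1; case/orP: rz1 => // rz1K.
  case/setCP: z1Z; apply: outK rz1K _.
  by rewrite adj_sym; apply: (rho_face).
have nw t : G w t -> w != rho w t.
  move=> wt; apply: contraTN (wt) => /eqP e.
  by rewrite -(adj_rho rotG) -e adj_irrefl.
have [/perm_inj e|ne] := eqVneq (rho w k1) (rho w z1).
  by move: z1Z; rewrite -e !inE k1K.
suff : 2 < #|S| by rewrite ltnNge leS2.
apply/card_gt2P; exists w, (rho w k1), (rho w z1).
by rewrite ne nw // eq_sym nw.
Qed.

(** Three common neighbours of u and w are also adjacent to the twin v of u, which would give a
    K_{3,3}. *)
Lemma twins_common_neighbours u v w x y z :
    u != v -> G u =1 G v -> G u w -> x != y ->
    G u x && G w x -> G u y && G w y -> G u z && G w z ->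
  (z == x) || (z == y).
Proof.
move=> uv eqN uw xy /andP[ux wx] /andP[uy wy] /andP[uz wz]; apply/norP => -[zx zy].
have ne s t : G s t -> s != t.
  by move=> st; apply: contraTN st => /eqP->; rewrite adj_irrefl.
apply: (@no_K33 V G rho rotG conG eulerG u v w x y z).
- by rewrite /= !inE negb_or uv ne // ne // -eqN.
- by rewrite /= !inE negb_or xy ![_ == z]eq_sym zx zy.
move=> s t; rewrite !inE => /or3P[]/eqP-> /or3P[]/eqP-> //; by rewrite -eqN.
Qed.

(* Twins with neighbourhood S: by [no_K33] every w in S has at most two
   neighbours in S, so the rotation at w is u p v q with p, q in S. *)
Lemma twins_span u v :
    u != v -> G u =1 G v ->
  (forall w, G u w -> #|[set y | G w y]| <= 4) /\
  (forall w, [|| w == u, w == v | G u w]).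
Proof.
move=> uv eqN.
have Nw w : G u w -> [set y | G w y] \subset [set u; v; rho w u; rho w v].
  move=> uw; have vw : G v w by rewrite -eqN.
  have [wu wv] : G w u /\ G w v by rewrite !(adj_sym G w).
  have common x y : G w x -> G w y -> y \in [set u; v] ->
      (rho w x = y) \/ (rho w y = x) -> G u x && G w x.
    move=> wx wy yuv rxy; rewrite wx andbT.
    have xy : G y x.
      by case: rxy => <-; [rewrite adj_sym|]; apply: (rho_face).
    by move: yuv xy; rewrite !inE => /orP[]/eqP-> //; rewrite eqN.
  have [p' wp' rp'] := adj_rho_inv rotG wu.
  have [q' wq' rq'] := adj_rho_inv rotG wv.
  have pq' : p' != q' by apply: contraNneq uv => e; rewrite -rp' -rq' e.
  have mu : u \in [set u; v] by rewrite !inE eqxx.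
  have mv : v \in [set u; v] by rewrite !inE eqxx orbT.
  have cp' := common p' u wp' wu mu (or_introl rp').
  have cq' := common q' v wq' wv mv (or_introl rq').
  (* The successor of u or v around w is a common neighbour of u and w, hence one of the
     predecessors [p'], [q'] of u and v. So the four listed vertices are closed under [rho w]. *)
  have back t : t \in [set u; v] -> rho w (rho w t) \in [set u; v].
    move=> tuv; have wt : G w t by move: tuv; rewrite !inE => /orP[]/eqP->.
    have wrt : G w (rho w t) by rewrite adj_rho.
    have := twins_common_neighbours uv eqN uw pq' cp' cq'
              (common (rho w t) t wrt wt tuv (or_intror erefl)).
    by case/orP=> /eqP->; rewrite ?rp' ?rq'.
  have sub : {subset [set u; v] <= [set u; v; rho w u; rho w v]}.
    by move=> t; rewrite !inE -!orbA => /orP[]->; rewrite ?orbT.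
  apply/subsetP => y; rewrite inE; apply: (rho_closed rotG wu); first exact: sub.
  have memE t : (t \in [set u; v; rho w u; rho w v]) =
      [|| t == u, t == v, t == rho w u | t == rho w v] by rewrite !inE -!orbA.
  move=> t _; rewrite {1}memE => /or4P[]/eqP->; rewrite ?(sub _ (back _ _)) //.
    by rewrite memE eqxx !orbT.
  by rewrite memE eqxx !orbT.
split=> [w /Nw/subset_leq_card/leq_trans->//|w].
  by rewrite !cardsU !cards1; lia.
have : w \in [set w | [|| w == u, w == v | G u w]]; last by rewrite inE.
apply: (connected_closed conG (x := u)) => [|y z]; first by rewrite inE eqxx.
rewrite !inE => /or3P[/eqP->->|/eqP->|uy yz]; rewrite ?orbT //.
  by rewrite -eqN => ->; rewrite !orbT.
have /subsetP/(_ z) := Nw y uy; rewrite !inE yz => /(_ isT).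
rewrite -!orbA => /or4P[->|->|/eqP->|/eqP->]; rewrite ?orbT //.
  by rewrite (rho_face) ?orbT // adj_sym.
by rewrite eqN (rho_face) ?orbT // adj_sym -eqN.
Qed.

End Triangulation.

(** * Connected triples as triples with at least two edges, and degree-sum arithmetic *)

Lemma connected_tripleE (V : finType) (G : sgraph V) x y z :
    uniq [:: x; y; z] ->
  ([set x; y; z] \in connected_triples G) =
    [|| G x y && G y z, G x y && G x z | G x z && G y z].
Proof.
rewrite /= !inE negb_or => /andP[/andP[xy xz] /andP[yz _]].
have -> : #|[set x; y; z]| == 3.
  by rewrite setUC cardsU1 cards2 !inE xy ![z == _]eq_sym (negPf xz) (negPf yz).
pose A := [set x; y; z]; rewrite -/A /=; apply/andP/idP => [[_ /forall_inP conA]|].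
  (* In a connected triple no vertex is isolated: the first step of a path leads to a neighbour
     inside the triple. *)
  have nb s t : s \in A -> t \in A -> s != t -> [|| G s x, G s y | G s z].
    move=> sA tA st; have /forall_inP/(_ t tA)/connectP[p] := conA s sA.
    case: p => [_ e|r p /= /andP[/and3P[_ rA sr] _] _]; first by rewrite e eqxx in st.
    by move: rA; rewrite !inE -orbA => /or3P[]/eqP<-; rewrite sr ?orbT.
  have [xA yA zA] : [/\ x \in A, y \in A & z \in A] by rewrite !inE !eqxx !orbT.
  have zy : z != y by rewrite eq_sym.
  move: (nb x y xA yA xy) (nb y z yA zA yz) (nb z y zA yA zy).
  rewrite !adj_irrefl (adj_sym G y x) !(adj_sym G z).
  by case: (G x y) (G x z) (G y z) => [] [] [].
have [xA yA zA] : [/\ x \in A, y \in A & z \in A] by rewrite !inE !eqxx !orbT.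
have ce s t : s \in A -> t \in A -> G s t ->
    connect (induced_rel G A) s t * connect (induced_rel G A) t s.
  by move=> sA tA st; split; apply: connect1; apply/and3P; split; rewrite // adj_sym.
(* Conversely, two edges of a triple share an end m, through which all its vertices are joined. *)
have star m s t : m \in A -> s \in A -> t \in A -> A \subset [set m; s; t] -> G m s -> G m t ->
    A != set0 /\ [forall a in A, forall b in A, connect (induced_rel G A) a b].
  move=> mA sA tA /subsetP subA ms mt; split; first by apply/set0Pn; exists m.
  have cm r : r \in A -> connect (induced_rel G A) r m * connect (induced_rel G A) m r.
    by move/subA; rewrite !inE -orbA => /or3P[]/eqP->; rewrite ?connect0 ?(ce m s) ?(ce m t).
  apply/forall_inP => a aA; apply/forall_inP => b bA.
  by apply: connect_trans (cm b bA).2; exact: (cm a aA).1.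
case/or3P=> /andP[e1 e2].
- have yx : G y x by rewrite adj_sym.
  apply: (star y x z) => //; apply/subsetP => r.
  by rewrite !inE => /orP[/orP[]|]->; rewrite ?orbT.
- by apply: (star x y z).
have [zx zy] : G z x /\ G z y by rewrite !(adj_sym G z).
apply: (star z x y) => //; apply/subsetP => r.
by rewrite !inE => /orP[/orP[]|]->; rewrite ?orbT.
Qed.

(** For k = |K| and t = |S|, the degree sums a over K and b over S are together too large. For t = 0
    the excess is at least (k - 2)(k - 6), which vanishes at the octahedron, k = 6; this is where 7
    vertices matter. *)
Lemma dense_degree_sum k t a b :
    t <= 2 -> 7 <= k + t -> k * (k + t - 2) <= a -> t * k <= b ->
  a + b + 12 != 6 * (k + t).
Proof.
move=> let2 le7; have [j kE] : exists j, k = j + 5 by exists (k - 5); lia.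
rewrite {k}kE in le7 *.
rewrite (_ : j + 5 + t - 2 = j + t + 3); last by lia.
by case: t let2 le7 => [|[|[|//]]] _ le7 lea leb; apply/eqP; nia.
Qed.

(** Here the total is too small: its upper bound grows in k with slope 2t + 1, at most 5, against
    6. *)
Lemma sparse_degree_sum k t a b :
    t <= 2 -> 7 <= k + t -> a <= k * (t + 1) -> b <= t * (k + t - 1) ->
  a + b + 12 != 6 * (k + t).
Proof.
move=> let2 le7; have [j kE] : exists j, k = j + 5 by exists (k - 5); lia.
rewrite {k}kE in le7 *.
rewrite (_ : j + 5 + t - 1 = j + t + 4); last by lia.
by case: t let2 le7 => [|[|[|//]]] _ le7 lea leb; apply/eqP; lia.
Qed.

(** * The difference graph: local structure *)

Section Difference.
Variables (V : finType) (G H : sgraph V).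
Hypothesis eqT : connected_triples G = connected_triples H.

Definition diff : rel V := [rel x y | G x y != H x y].

Lemma diff_sym : symmetric diff.
Proof. by move=> x y; rewrite /diff /= (adj_sym G x) (adj_sym H x). Qed.

Lemma diff_irrefl x : diff x x = false.
Proof. by rewrite /diff /= !adj_irrefl. Qed.

Lemma diff_neq x y : diff x y -> x != y.
Proof. by apply: contraTneq => ->; rewrite diff_irrefl. Qed.

(** If uv and uw were both edges of G only, the triple would have at least two edges in G and at
    most one in H. *)
Lemma diff_alternate u v w : v != w -> diff u v -> diff u w -> G u v != G u w.
Proof.
move=> vw uv uw; have uniq3 : uniq [:: v; u; w].
  by rewrite /= !inE negb_or vw [v == u]eq_sym !diff_neq.
move: (connected_tripleE G uniq3) (connected_tripleE H uniq3) uv uw.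
rewrite eqT => ->; rewrite /diff /= !(adj_sym _ v u).
by case: (G u v) (G u w) (G v w) (H u v) (H u w) (H v w) => [] [] [] [] [] [].
Qed.

(** If exactly one of uw, vw were an edge, in both graphs alike, then uv would decide whether the
    triple is connected. *)
Lemma diff_module u v w :
  diff u v -> w != u -> w != v -> ~~ diff u w -> ~~ diff v w -> G u w = G v w.
Proof.
move=> uv wu wv uw vw; have uniq3 : uniq [:: u; v; w].
  by rewrite /= !inE negb_or ![_ == w]eq_sym wu wv diff_neq.
move: (connected_tripleE G uniq3) (connected_tripleE H uniq3) uv uw vw.
rewrite eqT => ->; rewrite /diff /=.
by case: (G u v) (G u w) (G v w) (H u v) (H u w) (H v w) => [] [] [] [] [] [].
Qed.

Lemma diff_deg2 a x y z :
  x != y -> diff a x -> diff a y -> diff a z -> (z == x) || (z == y).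
Proof.
move=> xy ax ay az; apply/norP => -[zx zy].
move: (diff_alternate xy ax ay) (diff_alternate zx az ax) (diff_alternate zy az ay).
by case: (G a x) (G a y) (G a z) => [] [] [].
Qed.

Lemma card_diff a : #|[set x | diff a x]| <= 2.
Proof.
rewrite leqNgt; apply/card_gt2P => -[x [y [z [[]]]]].
rewrite !in_set => ax ay az [xy yz zx]; have := diff_deg2 xy ax ay az.
by rewrite (negPf zx) eq_sym (negPf yz).
Qed.

(** Along the path b, a1, a, a2, b' of differences, two applications of [diff_module] turn either
    side into [G a1 a2]. If a1 = a2, the degree bound gives b = b'. *)
Lemma diff_far a a1 b a2 b' :
    diff a a1 -> diff a1 b -> b != a -> ~~ diff a b ->
    diff a a2 -> diff a2 b' -> b' != a -> ~~ diff a b' ->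
  G a b = G a b'.
Proof.
move=> aa1 a1b ba ab aa2 a2b' b'a ab'.
have [->//|bb'] := eqVneq b b'.
have [a1a a2a] : diff a1 a /\ diff a2 a by rewrite !(diff_sym _ a).
have [e|a12] := eqVneq a1 a2.
  have := diff_deg2 b'a (etrans (congr1 (diff^~ b') e) a2b') a1a a1b.
  by rewrite (negPf bb') (negPf ba).
have a2b : ~~ diff a2 b.
  by apply/negP => /(diff_deg2 b'a a2b' a2a); rewrite (negPf bb') (negPf ba).
have a1b' : ~~ diff a1 b'.
  apply/negP => /(diff_deg2 ba a1b a1a).
  by rewrite eq_sym (negPf bb') (negPf b'a).
have a1a2 : ~~ diff a1 a2.
  apply/negP => /(diff_deg2 ba a1b a1a) /orP[]/eqP e.
    by rewrite -e aa2 in ab.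
  by rewrite e diff_irrefl in aa2.
have [ba1 ba2] : b != a1 /\ b != a2.
  by split; apply: contraNneq ab => ->.
have [b'a1 b'a2] : b' != a1 /\ b' != a2.
  by split; apply: contraNneq ab' => ->.
rewrite (diff_module aa2) // (diff_module aa1 b'a) //.
rewrite (adj_sym G a2) -(diff_module a1b) //; try by rewrite 1?eq_sym // diff_sym.
by rewrite (adj_sym G a1 b') -(diff_module a2b') 1?adj_sym // 1?eq_sym // diff_sym.
Qed.

(** * A component of the difference graph as a module *)

Variable x0 : V.

Definition component : {set V} := [set y | connect diff x0 y].
Local Notation K := component.

Definition attachment : {set V} := [set w | (w \notin K) && G x0 w].
Local Notation S := attachment.

Lemma mem_attachment w : (w \in S) = (w \notin K) && G x0 w.
Proof. by rewrite in_set. Qed.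

Lemma connect_diff_sym : connect_sym diff.
Proof. exact/sym_connect_sym/diff_sym. Qed.

Lemma component_root : x0 \in K. Proof. by rewrite inE. Qed.

Lemma component_closed y z : y \in K -> diff y z -> z \in K.
Proof. by rewrite !inE => xy yz; apply: connect_trans xy (connect1 yz). Qed.

Lemma component_connect y z : y \in K -> z \in K -> connect diff y z.
Proof. by rewrite !inE connect_diff_sym; apply: connect_trans. Qed.

(** A vertex outside K is in no difference with K, so [diff_module] carries its adjacency along the
    paths of differences from x0. *)
Lemma component_module y w : y \in K -> w \notin K -> G y w = (w \in S).
Proof.
move=> yK wK; rewrite inE wK /=.
have : y \in [set y in K | G y w == G x0 w].
  have xy : connect diff x0 y by rewrite inE in yK.
  apply: connect_closed xy => [s t|]; rewrite !inE ?connect0 ?eqxx //.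
  case/andP=> sK /eqP<- st; have tK := connect_trans sK (connect1 st).
  rewrite tK /=; apply/eqP/esym/diff_module => //.
  - by apply: contraNneq wK => ->; rewrite inE.
  - by apply: contraNneq wK => ->; rewrite inE.
  - by apply: contraNN wK; apply: component_closed; rewrite inE.
  - by apply: contraNN wK; apply: component_closed; rewrite inE.
by rewrite inE => /andP[_ /eqP].
Qed.

(** On a path of differences from a to z, adjacency to a is constant after the last vertex equal or
    different-adjacent to a; the next vertex serves as b, at distance two from a. *)
Lemma diff_out a z :
    a \in K -> z \in K -> z != a -> ~~ diff a z ->
  exists b a1, [/\ diff a a1, diff a1 b, b != a, ~~ diff a b & G a z = G a b].
Proof.
move=> aK zK za az.
pose far b := [exists a1, [&& diff a a1, diff a1 b, b != a & ~~ diff a b]].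
have : z \in [set z | [|| z == a, diff a z | [exists b, far b && (G a z == G a b)]]].
  apply: connect_closed (component_connect aK zK) => [s t|]; last by rewrite inE eqxx.
  rewrite !inE => sA st.
  have [//|ta] := eqVneq t a; have [//|at_] := boolP (diff a t).
  have [sa|sa] := eqVneq s a; first by rewrite -sa st in at_.
  have [as_|as_] := boolP (diff a s).
    apply/existsP; exists t; rewrite eqxx andbT; apply/existsP; exists s.
    by rewrite as_ st ta.
  move: sA; rewrite (negPf sa) (negPf as_) /= => /existsP[b /andP[fb /eqP gb]].
  apply/existsP; exists b; rewrite fb -gb adj_sym (adj_sym G a).
  by apply/eqP/esym/(diff_module st); rewrite 1?(eq_sym a) 1?(diff_sym _ a).
rewrite inE (negPf za) (negPf az) => /existsP[b /andP[/existsP[a1 /and4P[]]]].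
by move=> aa1 a1b ba ab /eqP gE; exists b, a1.
Qed.

Lemma diff_uniform_from a z z' :
    a \in K -> z \in K -> z != a -> ~~ diff a z ->
  z' \in K -> z' != a -> ~~ diff a z' -> G a z = G a z'.
Proof.
move=> aK zK za az z'K z'a az'.
have [b [a1 [aa1 a1b ba ab ->]]] := diff_out aK zK za az.
have [b' [a2 [aa2 a2b' b'a ab' ->]]] := diff_out aK z'K z'a az'.
exact: diff_far aa1 a1b ba ab aa2 a2b' b'a ab'.
Qed.

(** The ends of a difference have at most 2 + 2 difference neighbours, so five vertices in K leave
    one z that is in no difference with either. There [diff_module] passes the common value from one
    end to the other. *)
Lemma diff_uniform x1 :
    diff x0 x1 -> 5 <= #|K| ->
  exists tau, forall a z, a \in K -> z \in K -> z != a -> ~~ diff a z -> G a z = tau.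
Proof.
move=> x01 leK.
have common a a' : diff a a' ->
    exists z, [/\ z \in K, ~~ diff a z, ~~ diff a' z, z != a & z != a'].
  move=> aa'; have : ~~ (K \subset [set x | diff a x] :|: [set x | diff a' x]).
    apply: contraL leK => /subset_leq_card/leq_ltn_trans leK; rewrite -ltnNge; apply: leK.
    by have := card_diff a; have := card_diff a'; rewrite cardsU; lia.
  case/subsetPn => z zK; rewrite !in_setU !in_set => /norP[az a'z].
  exists z; split=> //; first by apply: contraNneq a'z => ->; rewrite diff_sym.
  by apply: contraNneq az => ->.
have [z0 [z0K x0z0 _ z0x0 _]] := common _ _ x01.
exists (G x0 z0) => a z aK zK za az.
pose P a := [forall z, [&& z \in K, z != a & ~~ diff a z] ==> (G a z == G x0 z0)].
have inP r : (r \in [set r | (r \in K) && P r]) = (r \in K) && P r by rewrite in_set.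
suff : a \in [set r | (r \in K) && P r].
  by rewrite inP => /andP[_ /forall_inP/(_ z)]; rewrite zK za az => /(_ isT)/eqP.
apply: connect_closed (component_connect component_root aK) => [s t|]; rewrite !inP.
  case/andP=> sK /forall_inP hs st; have tK := component_closed sK st.
  rewrite tK; apply/forall_inP => y /and3P[yK yt ty].
  have [r [rK sr tr rs rt]] := common _ _ st.
  rewrite (diff_uniform_from tK yK yt ty rK) // -(diff_module st) //.
  by apply: hs; rewrite rK rs.
rewrite component_root; apply/forall_inP => y /and3P[yK yx xy]; apply/eqP.
exact: (diff_uniform_from component_root).
Qed.

(** * Planarity bounds the components *)

Variable rho : V -> {perm V}.
Hypothesis rotG : rotation_system G rho.
Hypothesis conG : connected_graph G.
Hypothesis eulerG : #|V| + #|faces G rho| = #|edges G| + 2.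
Hypothesis triG : forall F, F \in faces G rho -> bounded_by_triangle G F.

Lemma small_component : 2 < #|S| -> #|K| <= 2.
Proof.
move=> /card_gt2P[a [b [c [[aS bS cS] [ab bc ca]]]]].
rewrite leqNgt; apply/card_gt2P => -[x [y [z [[xK yK zK] [xy yz zx]]]]].
apply: (@no_K33 V G rho rotG conG eulerG x y z a b c).
- by rewrite /= !inE negb_or xy yz eq_sym zx.
- by rewrite /= !inE negb_or ab bc eq_sym ca.
move=> s t sM tM.
have sK : s \in K by move: sM; rewrite !in_cons in_nil orbF => /or3P[]/eqP->.
have tS : t \in S by move: tM; rewrite !in_cons in_nil orbF => /or3P[]/eqP->.
by rewrite component_module //; move: tS; rewrite mem_attachment => /andP[].
Qed.

Lemma component_span : #|S| <= 2 -> K :|: S = setT.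
Proof.
move=> leS; apply: (no_small_cut rotG conG triG component_root leS) => [w|y z yK yz].
  by rewrite mem_attachment => /andP[_ xw]; exists x0; rewrite ?component_root // adj_sym.
have [zK|zK] := boolP (z \in K); first by rewrite in_setU zK.
by rewrite in_setU -(component_module yK zK) yz orbT.
Qed.

Lemma sum_degrees : \sum_x #|[set y | G x y]| + 12 = 6 * #|V|.
Proof.
rewrite -(card_darts eulerG triG); congr (_ + _).
rewrite -sum1_card (eq_bigl (fun d : V * V => predT d.1 && G d.1 d.2)); last first.
  by move=> d; rewrite inE.
rewrite -(pair_big_dep predT (fun x y => G x y) (fun _ _ => 1)) /=.
by apply: eq_bigr => x _; rewrite sum1dep_card.
Qed.

(* If |S| <= 2 then K and S exhaust V, and the degree sum 6 |V| - 12 can be met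
   neither when K is a matching in G nor when it is the complement of one. *)
Lemma large_attachment x1 : 7 <= #|V| -> diff x0 x1 -> 2 < #|S|.
Proof.
move=> leV x01; rewrite ltnNge; apply/negP => leS.
have KS := component_span leS.
have inS y : (y \in S) = (y \notin K).
  have : y \in K :|: S by rewrite KS in_setT.
  by rewrite in_setU mem_attachment; case: (y \in K).
have inN x y : (y \in [set y | G x y]) = G x y by rewrite in_set.
have cardV : #|K| + #|S| = #|V|.
  by rewrite -(cardsC K); congr (_ + _); apply: eq_card => y; rewrite inS in_setC.
have degE x : x \in K -> #|[set y | G x y]| = #|[set y in K | G x y]| + #|S|.
  move=> xK; rewrite setIdE setIC -(cardsID K); congr (_ + _); apply: eq_card => y.
  rewrite in_setD inS; case: (boolP (y \in K)) => //= yK.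
  by rewrite inN component_module // inS.
have [tau tauE] : exists tau, forall a z,
    a \in K -> z \in K -> z != a -> ~~ diff a z -> G a z = tau.
  by apply: diff_uniform x01 _; lia.
have := sum_degrees; rewrite -cardV (bigID (mem K)) /=.
have sumK n : \sum_(x in K) n = #|K| * n by rewrite sum_nat_const.
have sumS n : \sum_(x | x \notin K) n = #|S| * n.
  by rewrite sum_nat_const; congr (_ * _); apply: eq_card => x; rewrite inS.
(* By alternation, at most one difference at x is in G and at most one is not: these are the
   matchings. *)
have le1 (g : bool) x : #|[set y | diff x y && (G x y == g)]| <= 1.
  rewrite leqNgt; apply/card_gt1P => -[y [z []]]; rewrite !in_set.
  move=> /andP[xy /eqP gy] /andP[xz /eqP gz] yz.
  by have := diff_alternate yz xy xz; rewrite gy gz eqxx.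
(* If [tau] is true, x in K misses only itself and at most one other vertex; if false, it has at
   most one neighbour in K. *)
case: tau tauE => tauE.
  have degK x : x \in K -> #|K| + #|S| - 2 <= #|[set y | G x y]|.
    move=> xK; rewrite degE // -(cardsID [set y | G x y] K).
    have /subset_leq_card : K :\: [set y | G x y] \subset
        x |: [set y | diff x y && (G x y == false)].
      apply/subsetP => y; rewrite in_setD in_setU1 inN inE => /andP[xy yK].
      have [//|yx] := eqVneq y x; rewrite (negPf xy) eqxx andbT /=.
      by apply: contraNT xy => xy; rewrite tauE // inE.
    rewrite cardsU1 -setIdE; have := le1 false x; lia.
  have degS x : x \notin K -> #|K| <= #|[set y | G x y]|.
    move=> xK; apply: subset_leq_card; apply/subsetP => y yK.
    by rewrite inN adj_sym component_module // inS.
  have : \sum_(x in K) (#|K| + #|S| - 2) <= \sum_(x in K) #|[set y | G x y]|.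
    exact: leq_sum.
  have : \sum_(x | x \notin K) #|K| <= \sum_(x | x \notin K) #|[set y | G x y]|.
    exact: leq_sum.
  rewrite sumK sumS => leb lea; apply/eqP.
  by apply: dense_degree_sum; rewrite // cardV.
have degK x : x \in K -> #|[set y | G x y]| <= #|S| + 1.
  move=> xK; rewrite degE // addnC leq_add2l; apply: leq_trans (le1 true x).
  apply: subset_leq_card; apply/subsetP => y; rewrite setIdE in_setI inN inE => /andP[yK xy].
  have yx : y != x by apply: contraTneq xy => ->; rewrite adj_irrefl.
  by apply/andP; split; [apply: contraT => Nxy; move: xy; rewrite tauE|rewrite xy].
have degS x : #|[set y | G x y]| <= #|K| + #|S| - 1.
  have : [set y | G x y] \subset ~: [set x].
    apply/subsetP => y; rewrite !inE; apply: contraTneq => ->.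
    by rewrite adj_irrefl.
  by move=> /subset_leq_card; rewrite cardsC1 cardV subn1.
have : \sum_(x in K) #|[set y | G x y]| <= \sum_(x in K) (#|S| + 1) by exact: leq_sum.
have : \sum_(x | x \notin K) #|[set y | G x y]| <=
    \sum_(x | x \notin K) (#|K| + #|S| - 1) by exact: leq_sum.
rewrite sumK sumS => leb lea; apply/eqP.
by apply: sparse_degree_sum; rewrite // cardV.
Qed.

Lemma diff_isolated x1 :
    7 <= #|V| -> diff x0 x1 ->
  forall w, w != x0 -> w != x1 -> [/\ ~~ diff x0 w, ~~ diff x1 w & G x0 w = G x1 w].
Proof.
move=> leV x01 w w0 w1; have := small_component (large_attachment leV x01).
have x1K := component_closed component_root x01.
have wK : #|K| <= 2 -> w \notin K.
  rewrite leqNgt; apply: contraNN => wK; apply/card_gt2P; exists x0, x1, w.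
  by rewrite component_root x1K wK diff_neq // eq_sym w1 w0.
move=> /wK{}wK; split; last by rewrite !component_module ?component_root.
  by apply: contraNN wK; apply: component_closed component_root.
by apply: contraNN wK; apply: component_closed.
Qed.

End Difference.

(** * Conclusion: twins in both graphs are incompatible *)

Theorem theorem4 (V : finType) (G H : sgraph V) :
  7 <= #|V| ->
  triangulated_planar G -> triangulated_planar H ->
  connected_triples G = connected_triples H ->
  edges G = edges H.
Proof.
move=> leV [rG [[conG rotG eulerG] triG]] [rH [[conH rotH eulerH] triH]] eqT.
have [eqD|neqD] := eqVneq (darts G) (darts H); first by rewrite /edges eqD.
have cardD : #|darts G| = #|darts H|.
  by apply: (@addIn 12); rewrite (card_darts eulerG triG) (card_darts eulerH triH).
have [u [v [Guv Huv]]] : exists u v, G u v /\ ~~ H u v.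
  have : ~~ (darts G \subset darts H).
    by apply: contraNN neqD => sub; rewrite eqEcard sub cardD leqnn.
  by case/subsetPn=> -[u v]; rewrite !inE; exists u, v.
have [x [y [Hxy Gxy]]] : exists x y, H x y /\ ~~ G x y.
  have : ~~ (darts H \subset darts G).
    by apply: contraNN neqD => sub; rewrite eq_sym eqEcard sub cardD leqnn.
  by case/subsetPn=> -[x y]; rewrite !inE; exists x, y.
have duv : diff G H u v by rewrite /diff /= Guv (negPf Huv).
have dxy : diff G H x y by rewrite /diff /= Hxy (negPf Gxy).
have isol s t : diff G H s t -> forall w, w != s -> w != t ->
    [/\ ~~ diff G H s w, ~~ diff G H t w & G s w = G t w].
  exact: (diff_isolated eqT rotG conG eulerG triG leV).
have twinsH : H u =1 H v.
  move=> w; have [->|wu] := eqVneq w u; first by rewrite adj_irrefl adj_sym (negPf Huv).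
  have [->|wv] := eqVneq w v; first by rewrite adj_irrefl (negPf Huv).
  by have [/negPn/eqP<- /negPn/eqP<-] := isol _ _ duv w wu wv.
have twinsG : G x =1 G y.
  move=> w; have [->|wx] := eqVneq w x; first by rewrite adj_irrefl adj_sym (negPf Gxy).
  have [->|wy] := eqVneq w y; first by rewrite adj_irrefl (negPf Gxy).
  by have [] := isol _ _ dxy w wx wy.
have [deg4 spanH] := twins_span rotH conH eulerH triH (diff_neq duv) twinsH.
have [_ spanG] := twins_span rotG conG eulerG triG (diff_neq dxy) twinsG.
(* If x were u or v, then xy would be either a second difference at an end of uv or the pair uv
   itself, which is in G. *)
have Hux : H u x.
  have /or3P[/eqP xu|/eqP xv|//] := spanH x.
    have yu : y != u by rewrite -xu eq_sym (diff_neq dxy).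
    have [yv|yv] := eqVneq y v; first by rewrite xu yv Guv in Gxy.
    by have [] := isol _ _ duv y yu yv; rewrite -xu dxy.
  have yv : y != v by rewrite -xv eq_sym (diff_neq dxy).
  have [yu|yu] := eqVneq y u; first by rewrite xv yu adj_sym Guv in Gxy.
  by have [_] := isol _ _ duv y yu yv; rewrite -xv dxy.
(* The only difference at x is xy, so the n - 2 neighbours of x in G remain in H: at least five,
   where [deg4] allows four. *)
have : ~: [set x; y] \subset [set w | H x w].
  apply/subsetP => w; rewrite !inE negb_or => /andP[wx wy].
  have [/negPn/eqP<- _ _] := isol _ _ dxy w wx wy.
  by have := spanG w; rewrite (negPf wx) (negPf wy).
move=> /subset_leq_card/leq_trans/(_ (deg4 x Hux)).
by rewrite cardsCs setCK cards2 (diff_neq dxy); move: leV; lia.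
Qed.
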